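(* Let $\varphi:(0,\infty)\to\mathbb{R}$ be an arbitrary function increasing to $+\infty$ as $t\to\infty$. Then for every $\lambda\in\left[0,\frac{2}{\sqrt{3}}\right]$ there exists $\pmb{\theta}\in\mathbb{R}^2\setminus\mathbb{Q}^2$ such that (1) $d^{[2]}_{|\cdot|}(\pmb{\theta})=\lambda$; and (2) the sequence $(q_\nu)_{\nu\ge1}$ of best approximation denominators of $\pmb{\theta}$ (with respect to the Euclidean norm) satisfies $\frac{q_{\nu+1}}{q_\nu}\geqslant\varphi(\nu)$ for all $\nu$; in particular $m_{|\cdot|}(\pmb{\theta})=\infty$.
   Context: $|\cdot|$ denotes the Euclidean norm on $\mathbb{R}^2$. For $\pmb{\theta}\in\mathbb{R}^2$ and $t\ge1$ put $\psi_{\pmb{\theta}}(t)=\min_{q\in\mathbb{Z}_+,\,q\le t}\min_{\pmb{p}\in\mathbb{Z}^2}|q\pmb{\theta}-\pmb{p}|$ and $d^{[2]}_{|\cdot|}(\pmb{\theta})=\limsup_{t\to\infty} t\,(\psi_{\pmb{\theta}}(t))^2$. For $\pmb{\theta}\notin\mathbb{Q}^2$, $\psi_{\pmb\theta}$ is a positive, non-increasing, piecewise constant function, and the best approximation denominators are the unique integers $q_1=1<q_2<\dots<q_\nu<\dots$ such that $\psi_{\pmb{\theta}}(t)=\psi_{\pmb{\theta}}(q_{\nu-1})$ for $q_{\nu-1}\le t<q_\nu$ (i.e. the points where $\psi_{\pmb\theta}$ jumps). Define $m_{|\cdot|}(\pmb{\theta})=\limsup_{\nu\to\infty} q_\nu/q_{\nu-1}$.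 *)

(* Defs.v *)
From HB Require Import structures.
From mathcomp Require Import all_boot all_order all_algebra.
From mathcomp Require Import all_classical all_reals all_analysis.
From mathcomp Require Import lra.

Set Implicit Arguments.
Unset Strict Implicit.
Unset Printing Implicit Defensive.

Import Order.TTheory GRing.Theory Num.Theory.
Import numFieldNormedType.Exports.

Local Open Scope classical_set_scope.
Local Open Scope ring_scope.

(* The library norm `|x| on 'rV[R]_n is the sup norm, hence a separate
   definition. *)
Definition enorm (R : realType) (x : 'rV[R]_2) : R :=
  Num.sqrt (\sum_i x 0 i ^+ 2).

Definition approx_err (R : realType) (theta : 'rV[R]_2) (q : nat)
    (p : 'rV[int]_2) : R :=
  enorm (q%:R *: theta - map_mx intr p).

(* For 1 <= t this infimum is a minimum, see psi_min; for t < 1 it is the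
   infimum of the empty set, i.e. 0, and never matters. *)
Definition psi (R : realType) (theta : 'rV[R]_2) (t : R) : R :=
  inf [set e | exists (q : nat) (p : 'rV[int]_2),
         [/\ (0 < q)%N, q%:R <= t & e = approx_err theta q p]].

Definition d2 (R : realType) (theta : 'rV[R]_2) : \bar R :=
  limf_esup (fun t : R => (t * psi theta t ^+ 2)%:E) +oo.

Definition rational_point (R : realType) (theta : 'rV[R]_2) : Prop :=
  exists r : 'rV[rat]_2, theta = map_mx ratr r.

(* Indices start at 1: q 0 is unconstrained. The last clause says that psi
   does jump at each q_nu, which makes the sequence unique, see
   best_denoms_uniq. *)
Definition best_denoms (R : realType) (theta : 'rV[R]_2) (q : nat -> nat) :
    Prop :=
  [/\ q 1%N = 1%N,
      forall nu, (0 < nu)%N -> (q nu < q nu.+1)%N,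
      forall nu, (0 < nu)%N -> forall t : R,
        (q nu)%:R <= t < (q nu.+1)%:R -> psi theta t = psi theta (q nu)%:R
    & forall nu, (0 < nu)%N -> psi theta (q nu.+1)%:R != psi theta (q nu)%:R].

(* limsup of q_nu / q_(nu-1); the terms nu <= 1 do not affect it. *)
Definition ratio_limsup (R : realType) (q : nat -> nat) : \bar R :=
  limn_esup (fun nu => ((q nu)%:R / (q nu.-1)%:R : R)%:E).

Lemma nearest_int (R : realType) (x : R) :
  exists z : int, forall w : int, (x - z%:~R) ^+ 2 <= (x - w%:~R) ^+ 2.
Proof.
have /andP[h1 h2] := floor_itv x.
set f := Num.floor x in h1 h2.
rewrite intrD in h2.
have key (w : int) : w%:~R <= f%:~R :> R \/ f%:~R + 1 <= w%:~R :> R.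
  case: (lerP w f) => h; [left|right]; first by rewrite ler_int.
  by rewrite -[1]/(1%:~R) -intrD ler_int lezD1.
case: (lerP (x - f%:~R) (1 / 2)) => h.
  by exists f => w; case: (key w) => hw; nra.
by exists (f + 1) => w; rewrite intrD; case: (key w) => hw; nra.
Qed.

Lemma psi_min (R : realType) (theta : 'rV[R]_2) (t : R) : 1 <= t ->
  exists (q : nat) (p : 'rV[int]_2),
    [/\ (0 < q)%N, q%:R <= t, psi theta t = approx_err theta q p
      & forall (q' : nat) (p' : 'rV[int]_2), (0 < q')%N -> q'%:R <= t ->
          approx_err theta q p <= approx_err theta q' p'].
Proof.
move=> t1.
have best_p (q : nat) : exists p : 'rV[int]_2, forall p',
    approx_err theta q p <= approx_err theta q p'.
  have [g gP] := choice (fun i : 'I_2 => nearest_int (q%:R * theta 0 i)).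
  exists (\row_i g i) => p'; rewrite /approx_err /enorm ler_wsqrtr//.
  by apply: ler_sum => i _; rewrite !mxE.
have [p pP] := choice best_p.
have t0 : 0 <= t by apply: le_trans t1.
have n1 : (0 < Num.truncn t)%N by rewrite truncn_gt0.
case: (Order.TotalTheory.arg_minP (P := fun i : 'I_(Num.truncn t).+1 => (0 < i)%N)
  (fun i : 'I_(Num.truncn t).+1 => approx_err theta i (p i))
  (i0 := ord_max)) => //= q q0 qP.
have qt : q%:R <= t by rewrite -truncn_ge_nat// -ltnS.
have qmin (q' : nat) (p' : 'rV[int]_2) : (0 < q')%N -> q'%:R <= t ->
    approx_err theta q (p q) <= approx_err theta q' p'.
  move=> q'0 q't; apply: le_trans (pP q' p').
  have q'n : (q' < (Num.truncn t).+1)%N by rewrite ltnS truncn_ge_nat.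
  exact: (qP (Ordinal q'n)).
exists q, (p q); split => //; apply/eqP; rewrite eq_le; apply/andP; split.
  apply: ge_inf; last by exists q, (p q).
  by exists (approx_err theta q (p q)) => _ [q' [p' [? ? ->]]]; exact: qmin.
apply: lb_le_inf; first by exists (approx_err theta q (p q)), q, (p q).
by move=> _ [q' [p' [? ? ->]]]; exact: qmin.
Qed.

Lemma best_denoms_uniq (R : realType) (theta : 'rV[R]_2) (q q' : nat -> nat) :
  best_denoms theta q -> best_denoms theta q' ->
  forall nu, (0 < nu)%N -> q nu = q' nu.
Proof.
move=> [q1 qS qc qj] [q1' qS' qc' qj']; case=> // nu _.
elim: nu => [|nu IH]; first by rewrite q1 q1'.
case: (ltngtP (q nu.+2) (q' nu.+2)) => // h; exfalso.
- have /eqP := qj nu.+1 isT; apply; rewrite [in RHS]IH; apply: qc' => //.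
  by rewrite ltr_nat h ler_nat -IH ltnW// qS.
- have /eqP := qj' nu.+1 isT; apply; rewrite -[in RHS]IH; apply: qc => //.
  by rewrite ltr_nat h ler_nat IH ltnW// qS'.
Qed.

(* Main.v *)
(* The best approximations are built as primitive vectors of Z^3 satisfying
   z_(n+1) = a z_n + b z_(n-1) + z_(n-2) with a much larger than b and b large,
   so that three consecutive vectors always have determinant 1. Let P_n be the
   rational point of z_n. Projecting Z^3 along z_(n+1) gives a plane lattice of
   covolume 1 / q_(n+1), in which the image of z_n has squared length close to
   mu / q_(n+1) by the choice of a. Fine tuning of a makes a second basis vector
   project almost onto the midpoint of the first one, and then the image of z_n
   is the unique shortest vector up to sign as soon as mu < 2 / sqrt 3. All
   conditions hold on a small box around P_(n+1); theta is a common point of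
   these nested boxes, and mu tends to lambda along the construction. *)

Require Import Defs.
From HB Require Import structures.
From mathcomp Require Import all_boot all_order all_algebra.
From mathcomp Require Import all_classical all_reals all_analysis.
From mathcomp Require Import ring lra zify.

Set Implicit Arguments.
Unset Strict Implicit.
Unset Printing Implicit Defensive.

Import Order.TTheory GRing.Theory Num.Theory.
Import numFieldNormedType.Exports.

Local Open Scope classical_set_scope.
Local Open Scope ring_scope.

(** * Reduced quadratic forms and the choice of the coefficients *)

(** The middle term is at least [- A |j l|], and [|j l| + 1 <= j ^+ 2 + l ^+ 2], so the form is at
    least [A + (C - A) l ^+ 2]. Applied to the Gram matrix of a reduced basis, this makes the first
    basis vector strictly shorter than everything off its line. *)
Lemma reduced_form_min (R : realDomainType) (A B C : R) (j l : int) :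
  -A <= 2 * B <= A -> A < C -> l != 0 ->
  A < A * j%:~R ^+ 2 + 2 * B * j%:~R * l%:~R + C * l%:~R ^+ 2.
Proof.
move=> /andP[B1 B2] AC l0.
have A0 : 0 <= A by lra.
have jl : `|j * l| + 1 <= j ^+ 2 + l ^+ 2.
  have l1 : 1 <= `|l| by rewrite -gtz0_ge1 normr_gt0.
  rewrite normrM -(real_normK (num_real j)) -(real_normK (num_real l)).
  move: (normr_ge0 j) l1; move: `|j| `|l| => J L J0 L1.
  case: (leP J 0) => [J1|]; first by have -> : J = 0 by [lra]; nra.
  by rewrite gtz0_ge1 => J1; case: (leP J L) => JL; nra.
have l2 : 1 <= l ^+ 2.
  by rewrite -gtz0_ge1 exprn_even_gt0.
move: jl l2; rewrite -(ler_int R) !intrD !rmorphXn/= intr_norm intrM => jl.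
rewrite -(ler_int R) rmorphXn/= => l2.
move: jl l2; set J := j%:~R; set L := l%:~R => jl l2.
have n1 := ler_norm (J * L); have n2 := ler_norm (- (J * L)).
rewrite normrN in n2.
have BA : - (A * `|J * L|) <= 2 * B * (J * L).
  rewrite lerNl -mulNr.
  apply: le_trans (ler_norm _) _; rewrite normrM ler_wpM2r//.
  by rewrite ler_norml; lra.
nra.
Qed.

(** Modulo 1, [f] lies in [[1/2, 3/2)]. Descending from there in steps of [rho] cannot jump over a
    window of width [rho] just below [1/2]. *)
Lemma phase_shift (R : realType) (f rho : R) : 0 < rho ->
  exists (n : nat) (c : int), n%:R * rho <= 1 + rho /\
    1 / 2 - rho <= f - n%:R * rho + c%:~R <= 1 / 2.
Proof.
move=> rho0.
have /andP[h1 h2] := floor_itv (f - 1 / 2); rewrite intrD in h2.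
set c := Num.floor _ in h1 h2.
set w := (f - c%:~R - 1 / 2) / rho.
have w0 : 0 <= w by rewrite divr_ge0//; lra.
have wE : w * rho = f - c%:~R - 1 / 2 by rewrite divfK ?gt_eqF.
have /andP[h3 h4] := truncn_itv w0.
exists (Num.truncn w).+1, (- c).
move: h3 h4; rewrite intrN -natr1; set k : R := (Num.truncn w)%:R => h3 h4.
nra.
Qed.

(** For plane vectors with [Y = |y|^2], [X = |x|^2] and inner product [g], [V] is [|b y + x|^2] and
    [G] is the inner product of [b y + x] with [y]. For large [b] the leading terms dominate, so
    [G / V] has order [1 / b]. *)
Lemma large_multiple (R : realType) (Y g X K : R) : 0 < Y -> 0 <= X ->
  g ^+ 2 <= Y * X ->
  exists b : nat, let V := b%:R ^+ 2 * Y + 2 * b%:R * g + X in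
    let G := b%:R * Y + g in
    [/\ K <= b%:R /\ 1 <= (b%:R : R), b%:R * Y <= 2 * G, b%:R ^+ 2 * Y <= 4 * V,
        V <= 4 * (b%:R ^+ 2 * Y) & G * b%:R <= 2 * V].
Proof.
move=> Y0 X0 gYX.
pose m := Num.max (Num.max K 1) (Num.max (2 * `|g| / Y) (X / Y)).
exists (Num.truncn m).+1 => /=.
have : m < (Num.truncn m).+1%:R.
  apply: truncnS_gt.
set b : R := (_.+1)%:R.
rewrite !gt_max => /andP[/andP[bK b1] /andP[bg bX]].
rewrite ltr_pdivrMr// in bg; rewrite ltr_pdivrMr// in bX.
have n1 := ler_norm g; have n2 := ler_norm (- g); rewrite normrN in n2.
split; nra.
Qed.

(** This is where [2 / sqrt 3] enters. Since [f] is almost [1/2], [1 - f ^+ 2 <= 3/4 + rho], hence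
    [(A t)^2 (1 - f^2) < 1 = D t^2], that is [A^2 < D + B^2 = A C]. *)
Lemma reduced_basis (R : realType) (mu A B D f rho t : R) :
  0 < A -> 0 < t -> 0 < rho -> rho <= 1 -> A * t <= mu ->
  mu ^+ 2 * (3 / 4 + rho) < 1 -> B = A * f -> 1 / 2 - rho <= f <= 1 / 2 ->
  D * t ^+ 2 = 1 -> forall C, A * C = D + B ^+ 2 ->
  -A <= 2 * B <= A /\ A < C.
Proof.
move=> A0 t0 rho0 rho1 Amu mu1 -> /andP[f1 f2] Dt C ACE.
split; first by nra.
rewrite -(ltr_pM2l A0) ACE.
have t20 : 0 < t ^+ 2 by rewrite exprn_gt0.
rewrite -(ltr_pM2r t20) mulrDl Dt.
have Amu2 : (A * t) ^+ 2 <= mu ^+ 2 by rewrite ler_sqr// nnegrE; nra.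
have -> : A * A * t ^+ 2 = (A * t) ^+ 2 by ring.
have -> : (A * f) ^+ 2 * t ^+ 2 = (A * t) ^+ 2 * f ^+ 2 by ring.
have S0 : 0 <= (A * t) ^+ 2 by rewrite sqr_ge0.
move: Amu2 S0; set S := (A * t) ^+ 2 => Amu2 S0.
have : 1 - f ^+ 2 <= 3 / 4 + rho.
  by case: (lerP rho (1 / 2)) => h; nra.
nra.
Qed.

(* The next vector is [Z' = a Z + b Y + X]; [x], [y] are the errors of [X], [Y]
   at the rational point of [Z], [q'] is the denominator of [Z'], and [z] and
   [w - c z] are the errors of [Z] and [Y] at the rational point of [Z']. A
   large [b] makes the ratio of the inner product of [v] and [y] to [|v|^2]
   small; increasing [a] by one shifts the reduced coordinate of [w] along [z]
   by that ratio, so it can be tuned to almost [1 / 2]. *)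
Lemma choose_coefficients (R : realType)
    (q qY qX y1 y2 x1 x2 mu eps M : R) :
  0 < q -> 0 <= qY -> 0 <= qX -> (q * (x1 * y2 - x2 * y1)) ^+ 2 = 1 ->
  0 < mu -> 3 * mu ^+ 2 < 4 -> 0 < eps ->
  exists (a b : nat) (c : int),
    let v1 := b%:R * y1 + x1 in let v2 := b%:R * y2 + x2 in
    let q' := a%:R * q + b%:R * qY + qX in
    let z1 := - (q * v1 / q') in let z2 := - (q * v2 / q') in
    let w1 := y1 - qY * v1 / q' + c%:~R * z1 in
    let w2 := y2 - qY * v2 / q' + c%:~R * z2 in
    [/\ 0 < q' /\ M <= q', v1 ^+ 2 + v2 ^+ 2 <= eps * q' ^+ 2,
        0 < v1 * y1 + v2 * y2,
        mu - eps <= q' * (z1 ^+ 2 + z2 ^+ 2) <= mu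
      & [/\ 0 < z1 ^+ 2 + z2 ^+ 2,
         - (z1 ^+ 2 + z2 ^+ 2) <= 2 * (z1 * w1 + z2 * w2) <= z1 ^+ 2 + z2 ^+ 2
         & z1 ^+ 2 + z2 ^+ 2 < w1 ^+ 2 + w2 ^+ 2]].
Proof.
move=> q0 qY0 qX0 det1 mu0 mu3 eps0.
set Y := y1 ^+ 2 + y2 ^+ 2; set g := x1 * y1 + x2 * y2.
set X := x1 ^+ 2 + x2 ^+ 2.
have X0 : 0 <= X by rewrite addr_ge0// sqr_ge0.
have lagr : (x1 * y2 - x2 * y1) ^+ 2 = Y * X - g ^+ 2.
  by rewrite /Y /X /g; ring.
have gYX : g ^+ 2 <= Y * X by rewrite -subr_ge0 -lagr sqr_ge0.
have Y0 : 0 < Y.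
  rewrite lt_def addr_ge0 ?sqr_ge0// andbT; apply/eqP => Yz.
  have : q ^+ 2 * (Y * X - g ^+ 2) = 1 by rewrite -lagr -exprMn.
  by rewrite Yz; have := sqr_ge0 (q * g); rewrite exprMn; nra.
(* [K1] makes [rho], which is at most [2 / b], small enough for [reduced_basis]. [K2] gives the
   lower bound [mu - eps], [K3] the bound on [v], and [K4] gives [M <= q']. The final [2] ensures
   [rho <= 1]. *)
pose K1 := (2 * mu ^+ 2 + 1) / (1 - 3 / 4 * mu ^+ 2).
pose K2 := 4 * mu ^+ 2 * (11 * q + qY + qX) / (eps * (q ^+ 2 * Y)).
pose K3 := 4 * mu ^+ 2 / (eps * (q ^+ 4 * Y)).
pose K4 := 4 * mu * M / (q ^+ 2 * Y).
pose K := Num.max (Num.max K1 K2) (Num.max (Num.max K3 K4) 2).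
have [b /= []] := large_multiple K Y0 X0 gYX.
rewrite -/Y.
set bR : R := b%:R; set V := _ + X; set G := _ + g.
move=> [Kb b1] bG bV Vb GV.
move: Kb; rewrite !ge_max => /andP[/andP[bK1 bK2] /andP[/andP[bK3 bK4] b2]].
have d1 : 0 < 1 - 3 / 4 * mu ^+ 2 by lra.
have q20 : 0 < q ^+ 2 by rewrite exprn_gt0.
have d2 : 0 < q ^+ 2 * Y by rewrite mulr_gt0.
have d3 : 0 < q ^+ 4 * Y by rewrite mulr_gt0// exprn_gt0.
rewrite ler_pdivrMr// in bK1; rewrite ler_pdivrMr ?mulr_gt0// in bK2.
rewrite ler_pdivrMr ?mulr_gt0// in bK3; rewrite ler_pdivrMr// in bK4.
have bY0 : 0 < bR * Y by rewrite mulr_gt0//; lra.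
have G0 : 0 < G by lra.
have V0 : 0 < V by nra.
pose rho := G / V.
have rhoV : rho * V = G by rewrite divfK ?gt_eqF.
have rho0 : 0 < rho by rewrite divr_gt0.
have rhob : rho * bR <= 2 by rewrite -(ler_pM2r V0) mulrAC rhoV; lra.
have rho1 : rho <= 1 by nra.
have murho : mu ^+ 2 * (3 / 4 + rho) < 1 by nra.
(* The squared length of [z] times [q'] is [q^2 V / q']. Taking [a0] least above [q V / mu] brings
   it just below [mu]. *)
pose a0 := (Num.truncn (q * V / mu)).+1.
have a0l : q * V / mu < a0%:R by exact: truncnS_gt.
have a0u : a0%:R <= q * V / mu + 1.
  rewrite /a0 -natr1 lerD2r.
  have qV0 : 0 <= q * V / mu by rewrite divr_ge0 ?mulr_ge0 ?ltW.
  by have /andP[] := truncn_itv qV0.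
pose q0' := a0%:R * q + bR * qY + qX.
(* The phase is the coordinate along [z] of the error of [Y] when [a = a0]. Each unit added to [a]
   adds [q] to the denominator and so lowers the phase by [rho]. *)
have [n [c [nrho nc]]] := phase_shift (- (q0' / q * rho) + qY / q) rho0.
exists (a0 + n)%N, b, c => /=; rewrite -/bR.
set v1 := _ + x1; set v2 := _ + x2.
have VE : v1 ^+ 2 + v2 ^+ 2 = V by rewrite /v1 /v2 /V /Y /X /g; ring.
have GE : v1 * y1 + v2 * y2 = G by rewrite /v1 /v2 /G /Y /g; ring.
rewrite VE GE.
set q' := _ + qX.
have q'E : q' = q0' + n%:R * q by rewrite /q' /q0' natrD; ring.
have n0 : 0 <= n%:R :> R by rewrite ler0n.
have q'l : q ^+ 2 * V <= mu * q'.
  have : q * V < a0%:R * mu by rewrite -ltr_pdivrMr.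
  have : 0 <= bR * qY by rewrite mulr_ge0// ler0n.
  have : 0 <= n%:R * q by rewrite mulr_ge0// ltW.
  rewrite q'E /q0'.
  have : 0 < mu * q by rewrite mulr_gt0.
  nra.
have q'0 : 0 < q' by rewrite -(pmulr_rgt0 _ mu0) (lt_le_trans _ q'l)// mulr_gt0.
(* From [(n - 1) rho <= 1] and [rho >= 1 / (8 b)] follows [n <= 8 b + 1 <= 9 b]. *)
have nb : n%:R <= 9 * bR.
  have : n%:R * rho * V <= (1 + rho) * V by rewrite ler_pM2r.
  rewrite -mulrA mulrDl mul1r rhoV => h.
  case: (lerP (n%:R) (1 : R)) => n1; first by lra.
  have : (n%:R - 1) * (bR * Y) <= (n%:R - 1) * (2 * G).
    by rewrite ler_wpM2l//; lra.
  have b2Y : bR ^+ 2 * Y = bR * (bR * Y) by ring.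
  move=> h1; have : (n%:R - 1) * (bR * Y) <= (8 * bR) * (bR * Y) by lra.
  by rewrite ler_pM2r// => ?; lra.
(* The excess over [q^2 V] is linear in [b], whereas [V] is of order [b^2]; the tuning therefore
   costs less than [eps]. *)
have q'u : mu * q' <= q ^+ 2 * V + mu * (bR * (11 * q + qY + qX)).
  have : (a0%:R - 1) * mu <= q * V by rewrite -ler_pdivlMr// lerBlDr.
  have : n%:R * q <= 9 * bR * q by rewrite ler_pM2r.
  rewrite q'E /q0'.
  have : qX <= bR * qX by rewrite ler_peMl.
  have : q <= bR * q by rewrite ler_peMl// ltW.
  nra.
have t0 : 0 < q'^-1 by rewrite invr_gt0.
have q't : q' * q'^-1 = 1 by rewrite divff ?gt_eqF.
set z1 := - (q * v1 / q'); set z2 := - (q * v2 / q').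
set w1 := _ + c%:~R * z1; set w2 := _ + c%:~R * z2.
have AE : z1 ^+ 2 + z2 ^+ 2 = q ^+ 2 * V * q'^-1 ^+ 2.
  by rewrite -VE /z1 /z2; ring.
have AqE : (z1 ^+ 2 + z2 ^+ 2) * q' = q ^+ 2 * V * q'^-1.
  by rewrite AE expr2 -!mulrA [q'^-1 * q']mulrC q't mulr1.
have A0 : 0 < z1 ^+ 2 + z2 ^+ 2 by rewrite AE !mulr_gt0// exprn_gt0.
have Aqmu : (z1 ^+ 2 + z2 ^+ 2) * q' <= mu.
  by rewrite AqE ler_pdivrMr.
have Vb4 : bR * Y <= 4 * V by nra.
split => //.
- split => //.
  rewrite -(ler_pM2l mu0); apply: le_trans q'l.
  rewrite -(ler_pM2l (_ : 0 < 4)) //.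
  apply: (@le_trans _ _ (bR * (q ^+ 2 * Y))); first by lra.
  rewrite [leLHS](_ : _ = q ^+ 2 * (bR * Y)); last by ring.
  by rewrite [leRHS](_ : _ = q ^+ 2 * (4 * V)) ?ler_pM2l//; ring.
- have mu20 : 0 < mu ^+ 2 by rewrite exprn_gt0.
  rewrite -(ler_pM2l mu20).
  apply: (@le_trans _ _ (eps * (q ^+ 2 * V) ^+ 2)).
    have h : mu ^+ 2 <= eps * q ^+ 4 * V.
      have : (eps * q ^+ 4) * (bR * Y) <= (eps * q ^+ 4) * (4 * V).
        by rewrite ler_pM2l// mulr_gt0// exprn_gt0.
      by lra.
    have : mu ^+ 2 * V <= eps * q ^+ 4 * V * V by rewrite ler_pM2r.
    by lra.
  by rewrite [leRHS]mulrCA -exprMn ler_pM2l// ler_sqr// nnegrE ltW// mulr_gt0.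
- rewrite mulrC Aqmu andbT AqE ler_pdivlMr//.
  suff : mu * (bR * (11 * q + qY + qX)) <= eps * q' by lra.
  rewrite -(ler_pM2l mu0).
  apply: (@le_trans _ _ (eps * (q ^+ 2 * V))); last first.
    by rewrite [leRHS]mulrCA ler_pM2l.
  have := ler_wpM2l (ltW (lt_le_trans ltr01 b1)) bK2.
  have : (eps * q ^+ 2) * (bR ^+ 2 * Y) <= (eps * q ^+ 2) * (4 * V).
    by rewrite ler_pM2l// mulr_gt0.
  lra.
have [] := @reduced_basis _ mu (z1 ^+ 2 + z2 ^+ 2) (z1 * w1 + z2 * w2)
    ((z1 * w2 - z2 * w1) ^+ 2)
    (- (q0' / q * rho) + qY / q - n%:R * rho + c%:~R) rho q'
    A0 q'0 rho0 rho1 Aqmu murho _ nc _ (w1 ^+ 2 + w2 ^+ 2).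
- have -> : - (q0' / q * rho) + qY / q - n%:R * rho + c%:~R
      = - (q' / q * rho) + qY / q + c%:~R.
    by rewrite q'E; field; rewrite gt_eqF.
  rewrite /rho -VE -GE /w1 /w2 /z1 /z2.
  by field; rewrite VE !gt_eqF.
- have -> : (z1 * w2 - z2 * w1) = - (q * (x1 * y2 - x2 * y1)) / q'.
    by rewrite /w1 /w2 /z1 /z2 /v1 /v2; field; rewrite gt_eqF.
  by rewrite -exprMn divfK ?gt_eqF// sqrrN.
- by ring.
- by move=> h1 h2; split.
Qed.

(** * Integer vectors, determinants and projections *)

(* [(q, p1, p2)] stands for the approximation [(p1, p2) / q]. *)
Record zvec := ZVec { den : int; num1 : int; num2 : int }.

Definition zcomb (i j l : int) (X Y Z : zvec) : zvec :=
  ZVec (i * den X + j * den Y + l * den Z)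
       (i * num1 X + j * num1 Y + l * num1 Z)
       (i * num2 X + j * num2 Y + l * num2 Z).

Definition det3 (X Y Z : zvec) : int :=
  den X * (num1 Y * num2 Z - num2 Y * num1 Z)
  - num1 X * (den Y * num2 Z - num2 Y * den Z)
  + num2 X * (den Y * num1 Z - num1 Y * den Z).

(** Cramer's rule. *)
Lemma det3_span (X Y Z W : zvec) : det3 X Y Z = 1 ->
  W = zcomb (det3 W Y Z) (det3 X W Z) (det3 X Y W) X Y Z.
Proof.
case: X Y Z W => [a b c] [a' b' c'] [a'' b'' c''] [d e f] det1.
by rewrite /zcomb; congr ZVec; rewrite -[LHS]mul1r -det1 /det3 /=; ring.
Qed.

Lemma det3_step (a b : int) (X Y Z : zvec) :
  det3 Y Z (zcomb a b 1 Z Y X) = det3 X Y Z.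
Proof. by rewrite /det3 /=; ring. Qed.

(** The pair [(err1 z t, err2 z t)] is the projection of [z] along [(1, t)]; at [t = ratpt Z] it
    kills [Z]. *)
Definition err1 (R : realType) (z : zvec) (t : R * R) : R :=
  (den z)%:~R * t.1 - (num1 z)%:~R.

Definition err2 (R : realType) (z : zvec) (t : R * R) : R :=
  (den z)%:~R * t.2 - (num2 z)%:~R.

Definition sqerr (R : realType) (z : zvec) (t : R * R) : R :=
  err1 z t ^+ 2 + err2 z t ^+ 2.

Definition ratpt (R : realType) (z : zvec) : R * R :=
  ((num1 z)%:~R / (den z)%:~R, (num2 z)%:~R / (den z)%:~R).
Arguments ratpt {R} z.

(** Write [W = i Y + j Z + l Z']. Projection along [Z'] kills the last term; if [i] is nonzero
    [reduced_form_min] applies, otherwise the image is [j] times that of [Z], so only [|j| <= 1] can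
    fail to be longer. The negative inner product is kept for the tie-break in
    [complement_longer]. *)
Lemma next_vector (R : realType) (X Y Z : zvec) (mu eps M : R) :
  det3 X Y Z = 1 -> 0 < den Z -> 0 <= den Y -> 0 <= den X ->
  0 < mu -> 3 * mu ^+ 2 < 4 -> 0 < eps ->
  exists Z' : zvec, let c := ratpt Z : R * R in let c' := ratpt Z' : R * R in
    [/\ det3 Y Z Z' = 1, 0 < den Z' /\ M <= (den Z')%:~R,
        (c'.1 - c.1) ^+ 2 + (c'.2 - c.2) ^+ 2 <= eps,
        (c'.1 - c.1) * err1 Y c + (c'.2 - c.2) * err2 Y c < 0
      & [/\ mu - eps <= (den Z')%:~R * sqerr Z c' <= mu, 0 < sqerr Z c'
          & forall W : zvec, sqerr Z c' < sqerr W c' \/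
              exists i j : int, `|j| <= 1 /\ W = zcomb 0 j i Y Z Z']].
Proof.
move=> detXYZ Z0 Y0 X0 mu0 mu3 eps0.
set c : R * R := ratpt Z.
have q0 : 0 < (den Z)%:~R :> R by rewrite ltr0z.
have [|||a [b [k]]] := @choose_coefficients R (den Z)%:~R (den Y)%:~R
    (den X)%:~R (err1 Y c) (err2 Y c) (err1 X c) (err2 X c) mu eps M q0 _ _ _
    mu0 mu3 eps0.
- by rewrite ler0z.
- by rewrite ler0z.
- have -> : (den Z)%:~R * (err1 X c * err2 Y c - err2 X c * err1 Y c)
      = (det3 X Y Z)%:~R :> R.
    rewrite /err1 /err2 /c /det3 /=; field.
    by rewrite gt_eqF.
  by rewrite detXYZ expr1n.
move=> /=.
set q : R := (den Z)%:~R; set qY : R := (den Y)%:~R.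
set y1 := err1 Y c; set y2 := err2 Y c.
set v1 := _ + err1 X c; set v2 := _ + err2 X c; set q' := _ + (den X)%:~R.
set z1 := - (q * v1 / q'); set z2 := - (q * v2 / q').
set w1 := _ + k%:~R * z1; set w2 := _ + k%:~R * z2.
move=> [[q'0 Mq'] Veps Gpos muE [A0 AB AC]].
pose Z' := zcomb a%:Z b%:Z 1 Z Y X; exists Z'; cbv zeta; rewrite -/c.
set c' : R * R := ratpt Z'.
have q'E : (den Z')%:~R = q' by rewrite /q' /q /qY /=; ring.
have c1E : c'.1 - c.1 = - (v1 / q').
  have -> : c'.1 = (num1 Z')%:~R / q' by rewrite -q'E.
  rewrite /v1 /y1 /err1 /c /= /q' /q /qY; field.
  by rewrite -/q -/qY -/q' !gt_eqF.
have c2E : c'.2 - c.2 = - (v2 / q').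
  have -> : c'.2 = (num2 Z')%:~R / q' by rewrite -q'E.
  rewrite /v2 /y2 /err2 /c /= /q' /q /qY; field.
  by rewrite -/q -/qY -/q' !gt_eqF.
have ct1 : c'.1 = c.1 - v1 / q' by rewrite -c1E; ring.
have ct2 : c'.2 = c.2 - v2 / q' by rewrite -c2E; ring.
have eZ1 : err1 Z c' = z1.
  rewrite /err1 ct1 /c /ratpt /= /z1 -/q; field.
  by rewrite !gt_eqF.
have eZ2 : err2 Z c' = z2.
  rewrite /err2 ct2 /c /ratpt /= /z2 -/q; field.
  by rewrite !gt_eqF.
have eY1 : err1 Y c' = w1 - k%:~R * z1.
  by rewrite /w1 addrK {1}/err1 ct1 /y1 /err1 -/qY; ring.
have eY2 : err2 Y c' = w2 - k%:~R * z2.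
  by rewrite /w2 addrK {1}/err2 ct2 /y2 /err2 -/qY; ring.
have Z'0 : 0 < den Z' by rewrite -(ltr0z R) q'E.
have e'1 : err1 Z' c' = 0.
  by rewrite /err1 /c' /ratpt mulrC divfK ?subrr// q'E gt_eqF.
have e'2 : err2 Z' c' = 0.
  by rewrite /err2 /c' /ratpt mulrC divfK ?subrr// q'E gt_eqF.
have det' : det3 Y Z Z' = 1 by rewrite det3_step.
split => //.
- by rewrite q'E.
- rewrite c1E c2E !sqrrN !expr_div_n -mulrDl ler_pdivrMr// exprn_gt0//.
- rewrite c1E c2E -/y1 -/y2 !mulNr -opprD oppr_lt0.
  rewrite ![_ / q' * _]mulrAC -mulrDl divr_gt0//.
rewrite q'E /sqerr eZ1 eZ2; split => // W.
have [i [j [l ->]]] : exists i j l, W = zcomb i j l Y Z Z'.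
  by do 3!eexists; exact: det3_span det'.
set W' := zcomb _ _ _ _ _ _.
have eW1 : err1 W' c' = (j - k * i)%:~R * z1 + i%:~R * w1.
  transitivity (i%:~R * err1 Y c' + j%:~R * err1 Z c' + l%:~R * err1 Z' c').
    by rewrite /err1 /W' /=; ring.
  by rewrite eY1 eZ1 e'1; ring.
have eW2 : err2 W' c' = (j - k * i)%:~R * z2 + i%:~R * w2.
  transitivity (i%:~R * err2 Y c' + j%:~R * err2 Z c' + l%:~R * err2 Z' c').
    by rewrite /err2 /W' /=; ring.
  by rewrite eY2 eZ2 e'2; ring.
rewrite eW1 eW2.
have [i0|i0] := eqVneq i 0.
  have [j1|j1] := leP `|j| 1; first by right; exists l, j; rewrite /W' i0.
  left; rewrite i0 mulr0 subr0 !mul0r !addr0 !exprMn -mulrDr ltr_pMl//.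
  by rewrite -rmorphXn/= ltr1z -(real_normK (num_real j)) exprn_egt1.
left; apply: lt_le_trans (reduced_form_min (j - k * i) AB AC i0) _.
by rewrite le_eqVlt; apply/orP; left; apply/eqP; ring.
Qed.

(** * Passing from a rational point to a box around it *)

(** A single [eta] must serve all [e1], [e2]: below a given denominator there are still infinitely
    many vectors, with unbounded errors. *)
Lemma sq_gap_stable (R : realType) (f1 f2 g : R) : 0 < g ->
  exists2 eta : R, 0 < eta & forall e1 e2 d1 d2 h1 h2 : R,
    `|d1| <= eta -> `|d2| <= eta -> `|h1| <= eta -> `|h2| <= eta ->
    f1 ^+ 2 + f2 ^+ 2 + g <= e1 ^+ 2 + e2 ^+ 2 ->
    (f1 + h1) ^+ 2 + (f2 + h2) ^+ 2 <= (e1 + d1) ^+ 2 + (e2 + d2) ^+ 2.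
Proof.
move=> g0; set S := f1 ^+ 2 + f2 ^+ 2.
have S0 : 0 <= S by rewrite addr_ge0// sqr_ge0.
(* This [tau] makes the loss [tau (S + g)] equal to half of the gap [g]. The other half pays for
   [eta K], where [K] collects the two Young terms and the two upper bounds. *)
pose tau := g / (2 * (S + g)).
have Sg : 0 < 2 * (S + g) by lra.
have tau0 : 0 < tau by rewrite divr_gt0.
have tauE : tau * (2 * (S + g)) = g by rewrite divfK ?gt_eqF.
have tau1 : tau <= 1 / 2 by rewrite ler_pdivrMr//; lra.
pose K := 2 / tau + 2 * (`|f1| + `|f2|) + 2.
have K0 : 0 < K.
  by rewrite /K addr_gt0// ltr_wpDr ?divr_gt0// mulr_ge0// addr_ge0.
pose eta := Num.min 1 (g / 2 / K).
have eta0 : 0 < eta by rewrite lt_min ltr01 divr_gt0// divr_gt0.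
have eta1 : eta <= 1 by rewrite ge_min lexx.
have etaK : eta * K <= g / 2 by rewrite -ler_pdivlMr// ge_min lexx orbT.
exists eta => // e1 e2 d1 d2 h1 h2 d1e d2e h1e h2e ge.
have sq (d : R) : `|d| <= eta -> d ^+ 2 <= eta.
  rewrite -(real_normK (num_real d)) => de.
  by have := normr_ge0 d; nra.
(* Young's inequality, since [e] is unbounded *)
have young (e d : R) : `|d| <= eta ->
    (1 - tau) * e ^+ 2 - eta / tau <= (e + d) ^+ 2.
  move=> /sq d2'.
  have : d ^+ 2 / tau <= eta / tau by rewrite ler_pM2r ?invr_gt0.
  have : 0 <= tau * (e + d / tau) ^+ 2 by rewrite mulr_ge0 ?sqr_ge0// ltW.
  have -> : tau * (e + d / tau) ^+ 2 = tau * e ^+ 2 + 2 * (e * d) + d ^+ 2 / tau.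
    by field; rewrite gt_eqF.
  have := sqr_ge0 d.
  by rewrite sqrrD -mulr_natl; lra.
have up (f h : R) : `|h| <= eta -> (f + h) ^+ 2 <= f ^+ 2 + eta * (2 * `|f| + 1).
  move=> he; have := sq _ he.
  have : f * h <= `|f| * eta.
    by apply: le_trans (ler_norm _) _; rewrite normrM ler_wpM2l.
  by rewrite sqrrD -mulr_natl; lra.
have := young e1 _ d1e; have := young e2 _ d2e.
have := up f1 _ h1e; have := up f2 _ h2e.
have : (1 - tau) * (S + g) <= (1 - tau) * (e1 ^+ 2 + e2 ^+ 2).
  by rewrite ler_wpM2l//; lra.
have : eta * K = 2 * (eta / tau) + eta * (2 * (`|f1| + `|f2|) + 2).
  by rewrite /K; ring.
rewrite /S in tauE *; lra.
Qed.

Lemma sqerr_continuous (R : realType) (z : zvec) :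
  continuous (sqerr z : R * R -> R).
Proof.
move=> t; rewrite /sqerr /err1 /err2.
by apply: cvgD; rewrite expr2; apply: cvgM; apply: cvgB;
  [apply: cvgM|exact: cvg_cst|apply: cvgM|exact: cvg_cst
  |apply: cvgM|exact: cvg_cst|apply: cvgM|exact: cvg_cst];
  solve [exact: cvg_cst | exact: cvg_fst | exact: cvg_snd].
Qed.

(** At the rational point of [Z] every [sqerr] is an integer divided by [den Z] squared. *)
Lemma sqerr_ratpt_gap (R : realType) (U W Z : zvec) : 0 < den Z ->
  let c := ratpt Z : R * R in
  sqerr U c < sqerr W c -> sqerr U c + ((den Z)%:~R ^+ 2)^-1 <= sqerr W c.
Proof.
move=> Z0 /=; set c : R * R := ratpt Z.
have q0 : 0 < (den Z)%:~R :> R by rewrite ltr0z.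
have q20 : 0 < (den Z)%:~R ^+ 2 :> R by rewrite exprn_gt0.
have E (V : zvec) : exists n : int, sqerr V c = n%:~R / (den Z)%:~R ^+ 2.
  exists ((den V * num1 Z - num1 V * den Z) ^+ 2
    + (den V * num2 Z - num2 V * den Z) ^+ 2).
  by rewrite /sqerr /err1 /err2 /c /=; field; rewrite gt_eqF.
have [[m ->] [n ->]] := (E U, E W).
rewrite ltr_pM2r ?invr_gt0// ltr_int -lezD1 -(ler_int R) intrD => mn.
by rewrite -[X in _ + X <= _]mul1r -mulrDl ler_pM2r ?invr_gt0.
Qed.

Definition box (R : realType) (c : R * R) (r : R) : set (R * R) :=
  [set t | `|t.1 - c.1| <= r /\ `|t.2 - c.2| <= r].

(* The second clause concerns the preceding step: it makes [Z - Y] a worse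
   approximation than [Y], see complement_longer. *)
Definition good_step (R : realType) (lambda eps : R) (Y Z Z' : zvec)
    (t : R * R) : Prop :=
  let c := ratpt Z : R * R in
  [/\ forall W : zvec, 0 < den W < den Z' ->
        [\/ W = Z, W = zcomb 0 (-1) 1 Y Z Z' | sqerr Z t <= sqerr W t],
      (t.1 - c.1) * err1 Y c + (t.2 - c.2) * err2 Y c <= 0,
      `|(den Z')%:~R * sqerr Z t - lambda| <= eps
    & sqerr Z' t < sqerr Z t].

(** The bounds on the denominator force [i = 1] for [j = -1] and [i = 0] for [j = 1], and exclude
    [j = 0]. *)
Lemma short_coset (Y Z Z' : zvec) (i j : int) : 0 < den Z -> den Z < den Z' ->
  `|j| <= 1 -> 0 < den (zcomb 0 j i Y Z Z') < den Z' ->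
  zcomb 0 j i Y Z Z' = Z \/ zcomb 0 j i Y Z Z' = zcomb 0 (-1) 1 Y Z Z'.
Proof.
rewrite /= mul0r add0r => Z0 ZZ' j1 /andP[W0 W1].
have Z'0 : 0 < den Z' by exact: lt_trans Z0 ZZ'.
have lo (k : int) : i <= k -> i * den Z' <= k * den Z' by rewrite ler_pM2r.
have hi (k : int) : k <= i -> k * den Z' <= i * den Z' by rewrite ler_pM2r.
have : j = -1 \/ j = 0 \/ j = 1 by lia.
case=> [jE|[jE|jE]]; rewrite jE in W0 W1 *.
- right; have -> // : i = 1.
  have [/lo h|[//|/hi h]] : i <= 0 \/ i = 1 \/ 2 <= i by lia.
  + by lia.
  + by lia.
- exfalso; have [/lo h|/hi h] : i <= 0 \/ 1 <= i by lia.
  + by lia.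
  + by lia.
- left; have -> // : i = 0.
    have [/lo h|[//|/hi h]] : i <= -1 \/ i = 0 \/ 1 <= i by lia.
    + by lia.
    + by lia.
  by case: Z {Z0 ZZ' W0 W1} => a b c; rewrite /zcomb/=; congr ZVec; ring.
Qed.

(** At [ratpt Z'] all requirements hold with strict inequalities, hence on a neighbourhood;
    infinitely many competitors [W] are handled at once by the uniform gap. *)
Lemma next_box (R : realType) (X Y Z : zvec) (r lambda eps M : R) :
  det3 X Y Z = 1 -> 0 < den Z -> 0 <= den Y -> 0 <= den X -> 0 < r ->
  0 <= lambda -> 3 * lambda ^+ 2 <= 4 -> 0 < eps ->
  exists (Z' : zvec) (r' : R),
    [/\ det3 Y Z Z' = 1, M <= (den Z')%:~R, 2 * den Z <= den Z', 0 < r'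
      & box (ratpt Z') r' `<=` box (ratpt Z) r `&`
          good_step lambda eps Y Z Z'].
Proof.
move=> detXYZ Z0 Y0 X0 r0 l0 l3 eps0.
have [mu [mu0 mu3 mul]] : exists mu : R,
    [/\ 0 < mu, 3 * mu ^+ 2 < 4 & `|mu - lambda| <= eps / 4].
  pose s := Num.min (1 / 2) (eps / 4).
  have s0 : 0 < s by rewrite lt_min; apply/andP; split; lra.
  have s1 : s <= 1 / 2 by rewrite ge_min lexx.
  have se : s <= eps / 4 by rewrite ge_min lexx orbT.
  have l2 : lambda <= 3 / 2 by nra.
  (* A small move towards [1/2] leaves both endpoints [0] and [2 / sqrt 3]. *)
  exists (lambda + s * (1 / 2 - lambda)); split; [nra|nra|].
  rewrite addrAC subrr add0r normrM gtr0_norm//.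
  apply: le_trans se; rewrite -[leRHS]mulr1 ler_pM2l// ler_norml; lra.
pose e := Num.min (eps / 4) ((r / 2) ^+ 2).
have e0 : 0 < e by rewrite lt_min exprn_gt0 divr_gt0.
have eeps : e <= eps / 4 by rewrite ge_min lexx.
have er : e <= (r / 2) ^+ 2 by rewrite ge_min lexx orbT.
have [Z' /=] := @next_vector R X Y Z mu e (Num.max M (2 * den Z)%:~R)
  detXYZ Z0 Y0 X0 mu0 mu3 e0.
set c : R * R := ratpt Z; set c' : R * R := ratpt Z'.
rewrite ge_max ler_int.
move=> [det' [Z'0 /andP[MZ' ZZ'2]] ccE dotE [/andP[muL muU] sZ short]].
have ZZ' : den Z < den Z' by apply: lt_le_trans ZZ'2; rewrite ltr_pMl.
have q'0 : 0 < (den Z')%:~R :> R by rewrite ltr0z.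
have cc (x y : R) : x ^+ 2 + y ^+ 2 <= e -> `|x| < r.
  move=> xy; have : `|x| ^+ 2 <= (r / 2) ^+ 2.
    by rewrite real_normK ?num_real//; have := sqr_ge0 y; lra.
  have r2 : 0 <= r / 2 by lra.
  by rewrite ler_sqr ?nnegrE// => ?; lra.
have cv1 : (fun t : R * R => t.1) x @[x --> nbhs c'] --> c'.1 by exact: cvg_fst.
have cv2 : (fun t : R * R => t.2) x @[x --> nbhs c'] --> c'.2 by exact: cvg_snd.
have near_box : \forall t \near nbhs c', box c r t.
  have n1 : \forall t \near nbhs c', `|t.1 - c.1| < r.
    apply: (cvgr_lt (`|c'.1 - c.1|)); last exact: cc ccE.
    by apply: cvg_norm; apply: cvgB => //; exact: cvg_cst.
  have n2 : \forall t \near nbhs c', `|t.2 - c.2| < r.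
    apply: (cvgr_lt (`|c'.2 - c.2|)); last first.
      by rewrite addrC in ccE; exact: cc ccE.
    by apply: cvg_norm; apply: cvgB => //; exact: cvg_cst.
  by near=> t; split; apply: ltW; near: t.
have near_dot : \forall t \near nbhs c',
    (t.1 - c.1) * err1 Y c + (t.2 - c.2) * err2 Y c < 0.
  apply: cvgr_lt dotE.
  by apply: cvgD; apply: cvgM;
    first [exact: cvg_cst|apply: cvgB => //; exact: cvg_cst].
have near_lambda : \forall t \near nbhs c',
    `|(den Z')%:~R * sqerr Z t - lambda| < eps.
  apply: (cvgr_lt (`|(den Z')%:~R * sqerr Z c' - lambda|)).
    apply: cvg_norm; apply: cvgB; last exact: cvg_cst.
    by apply: cvgM; [exact: cvg_cst|exact: sqerr_continuous].
  move: mul; rewrite ler_norml ltr_norml => /andP[mul1 mul2].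
  by apply/andP; split; lra.
have near_dec : \forall t \near nbhs c', sqerr Z' t - sqerr Z t < 0.
  apply: (cvgr_lt (sqerr Z' c' - sqerr Z c')).
    by apply: cvgB; exact: sqerr_continuous.
  suff -> : sqerr Z' c' = 0 by rewrite sub0r oppr_lt0.
  by rewrite /sqerr /err1 /err2 /c' /ratpt/= ![_ * (_ / _)]mulrC !divfK
    ?gt_eqF// !subrr expr0n/= addr0.
have g0 : 0 < ((den Z')%:~R ^+ 2)^-1 :> R by rewrite invr_gt0 exprn_gt0.
have [eta eta0 etaP] := sq_gap_stable (err1 Z c') (err2 Z c') g0.
have near_best : \forall t \near nbhs c', forall W, 0 < den W < den Z' ->
    [\/ W = Z, W = zcomb 0 (-1) 1 Y Z Z' | sqerr Z t <= sqerr W t].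
  (* A displacement of [t] is multiplied by the denominator of the vector, which is at most
     [den Z']. *)
  apply/nbhs_ballP; exists (eta / (den Z')%:~R) => /=; first by rewrite divr_gt0.
  move=> t /= [b1 b2] W W01.
  rewrite /ball/= distrC in b1; rewrite /ball/= distrC in b2.
  have small (k : int) (x : R) : 0 < k <= den Z' ->
      `|x| < eta / (den Z')%:~R -> `|k%:~R * x| <= eta.
    move=> /andP[k0 kZ]; rewrite ltr_pdivlMr// => /ltW xe.
    apply: le_trans xe; rewrite normrM mulrC ler_wpM2l//.
    by rewrite gtr0_norm ?ltr0z// ler_int.
  have [lt|[i [j [j1 WE]]]] := short W; last first.
    rewrite WE in W01 *.
    by case: (short_coset Z0 ZZ' j1 W01) => ->; [constructor 1|constructor 2].
  constructor 3; have := sqerr_ratpt_gap Z'0 lt.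
  have errE1 (V : zvec) : err1 V t = err1 V c' + (den V)%:~R * (t.1 - c'.1).
    by rewrite /err1; ring.
  have errE2 (V : zvec) : err2 V t = err2 V c' + (den V)%:~R * (t.2 - c'.2).
    by rewrite /err2; ring.
  move: W01 => /andP[W0 /ltW W1].
  rewrite /sqerr !errE1 !errE2; apply: etaP; apply: small => //.
  - by rewrite W0.
  - by rewrite W0.
  - by rewrite Z0 ltW.
  - by rewrite Z0 ltW.
have : \forall t \near nbhs c', box c r t /\ good_step lambda eps Y Z Z' t.
  near=> t; split; first by near: t.
  split; first by near: t.
  - by apply: ltW; near: t.
  - by apply: ltW; near: t.
  - by rewrite -subr_lt0; near: t.
move=> /nbhs_ballP[d /= d0 dP].
exists Z', (d / 2); split => //; first by rewrite divr_gt0.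
move=> t [t1 t2]; apply: dP; split; rewrite /ball/= distrC.
- by apply: le_lt_trans t1 _; lra.
- by apply: le_lt_trans t2 _; lra.
Unshelve. all: by end_near.
Qed.

(** * The sequence of vectors and the common point of the boxes *)

Lemma zvec_sequence (R : realType) (phi : nat -> R) (lambda : R) :
  0 <= lambda -> 3 * lambda ^+ 2 <= 4 ->
  exists (z : nat -> zvec) (r : nat -> R),
    den (z 1%N) = 1 /\ forall n,
    [/\ 0 < den (z n.+1), 2 * den (z n.+1) <= den (z n.+2),
        phi n * (den (z n.+1))%:~R <= (den (z n.+2))%:~R, 0 < r n
      & box (ratpt (z n.+2)) (r n.+1) `<=` box (ratpt (z n.+1)) (r n) `&`
          good_step lambda n.+1%:R^-1 (z n) (z n.+1) (z n.+2)].
Proof.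
move=> l0 l3.
pose inv (s : zvec * zvec * zvec * R) := let: (X, Y, Z, r) := s in
  [/\ det3 X Y Z = 1, 0 < den Z, 0 <= den Y, 0 <= den X & 0 < r].
pose next (n : nat) (s s' : zvec * zvec * zvec * R) :=
  let: (X, Y, Z, r) := s in let: (X', Y', Z', r') := s' in
  [/\ X' = Y, Y' = Z, 2 * den Z <= den Z',
      phi n * (den Z)%:~R <= (den Z')%:~R
    & box (ratpt Z') r' `<=` box (ratpt Z) r `&`
          good_step lambda n.+1%:R^-1 Y Z Z'].
(* The invariant is a premise inside the existential, so that [choice] yields a total function to
   iterate. *)
have step (p : nat * (zvec * zvec * zvec * R)) :
    exists s', inv p.2 -> inv s' /\ next p.1 p.2 s'.
  case: p => n s; have [sI|sI] := pselect (inv s); last by exists s.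
  case: s sI => [[[X Y] Z] r] [detE Z0 Y0 X0 r0].
  have e0 : 0 < n.+1%:R^-1 :> R by rewrite invr_gt0.
  have [Z' [r' [det' MZ ZZ' r'0 sub]]] := @next_box R X Y Z r lambda
    n.+1%:R^-1 (phi n * (den Z)%:~R) detE Z0 Y0 X0 r0 l0 l3 e0.
  exists (Y, Z, Z', r') => _; split; split => //.
  - by apply: lt_le_trans ZZ'; rewrite mulr_gt0.
  - exact: ltW.
have [f fP] := choice step.
(* The start is a basis of determinant 1 whose last vector has denominator 1. The sequence reads off
   the middle component, so this last vector becomes [z 1]. *)
pose s := fix s n := if n is m.+1 then f (m, s m) else
  (ZVec 0 0 1, ZVec 0 (-1) 0, ZVec 1 0 0, 1 : R).
have sI n : inv (s n).
  elim: n => [|n IH]; last by have [] := fP (n, s n) IH.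
  by rewrite /inv /=; split => //; rewrite ?ltr01// /det3/=; ring.
have sN n : next n (s n) (s n.+1) by have [] := fP (n, s n) (sI n).
exists (fun n => (s n).1.1.2), (fun n => (s n).2).
have sZ n : (s n.+1).1.1.2 = (s n).1.2.
  move: (sN n); rewrite /next; case: (s n) => [[[X Y] Z] r].
  by case: (s n.+1) => [[[X' Y'] Z'] r'] [].
split=> [|n]; first by rewrite sZ.
rewrite !sZ; move: (sN n) (sI n); rewrite /next /inv.
case: (s n) => [[[X Y] Z] r]; case: (s n.+1) => [[[X' Y'] Z'] r'] /=.
by move=> [_ _ ? ? ?] [? ? ? ? ?]; split.
Qed.

Lemma nested_intervals (R : realType) (a r : nat -> R) :
  (forall n, 0 < r n) ->
  (forall n, a n - r n <= a n.+1 - r n.+1) ->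
  (forall n, a n.+1 + r n.+1 <= a n + r n) ->
  exists t, forall n, `|t - a n| <= r n.
Proof.
move=> r0 lo hi; pose l n := a n - r n; pose u n := a n + r n.
have lM : {homo l : m n / (m <= n)%N >-> m <= n}.
  by apply: homo_leq => // x y z; exact: le_trans.
have uM : {homo u : m n / (m <= n)%N >-> n <= m}.
  by apply: homo_leq => // x y z yx xz; exact: le_trans xz yx.
have lu m n : l m <= u n.
  have := lM _ _ (leq_maxl m n); have := uM _ _ (leq_maxr m n).
  by have := r0 (maxn m n); rewrite /l /u; lra.
exists (sup (range l)) => n; rewrite ler_distl; apply/andP; split.
  apply: ub_le_sup; last by exists n.
  by exists (u 0%N) => _ [m _ <-].
by apply: ge_sup; [exists (l 0%N), 0%N|move=> _ [m _ <-]; exact: lu].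
Qed.

Lemma nested_boxes (R : realType) (c : nat -> R * R) (r : nat -> R) :
  (forall n, 0 < r n) ->
  (forall n, box (c n.+1) (r n.+1) `<=` box (c n) (r n)) ->
  exists t, forall n, box (c n) (r n) t.
Proof.
move=> r0 sub.
(* Two opposite corners of the inner box give the endpoint inequalities in both coordinates. *)
have corner n (s : R) : `|s| <= r n.+1 ->
    box (c n) (r n) ((c n.+1).1 + s, (c n.+1).2 + s).
  by move=> sr; apply: sub; split; rewrite /= addrAC subrr add0r.
have lo n := corner n (- r n.+1); have hi n := corner n (r n.+1).
have rn n : `|r n| = r n by rewrite gtr0_norm.
have [t1 t1P] : exists t, forall n, `|t - (c n).1| <= r n.
  apply: nested_intervals => // n.
  - have []/= := lo n; first by rewrite normrN rn.
    by rewrite !ler_norml => /andP[? ?] _; lra.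
  - have []/= := hi n; first by rewrite rn.
    by rewrite !ler_norml => /andP[? ?] _; lra.
have [t2 t2P] : exists t, forall n, `|t - (c n).2| <= r n.
  apply: nested_intervals => // n.
  - have []/= := lo n; first by rewrite normrN rn.
    by rewrite !ler_norml => _ /andP[? ?]; lra.
  - have []/= := hi n; first by rewrite rn.
    by rewrite !ler_norml => _ /andP[? ?]; lra.
by exists (t1, t2) => n; split.
Qed.

(* [Z] and [Z' - Z] are equally good at the rational point of [Z']; the sign of
   the inner product breaks the tie. *)
Lemma complement_longer (R : realType) (Y Z Z' : zvec) (t : R * R) :
  0 < den Z' -> 2 * den Z <= den Z' ->
  let c := ratpt Z' : R * R in
  (t.1 - c.1) * err1 Z c + (t.2 - c.2) * err2 Z c <= 0 ->
  sqerr Z t <= sqerr (zcomb 0 (-1) 1 Y Z Z') t.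
Proof.
move=> Z'0 ZZ' /=; set c : R * R := ratpt Z' => dotE.
set d1 := t.1 - c.1 in dotE; set d2 := t.2 - c.2 in dotE.
have q'0 : 0 < (den Z')%:~R :> R by rewrite ltr0z.
have q2 : 2 * (den Z)%:~R <= (den Z')%:~R :> R.
  by rewrite -[2]/(2%:~R) -intrM ler_int.
rewrite -subr_ge0.
have -> : sqerr (zcomb 0 (-1) 1 Y Z Z') t - sqerr Z t = (den Z')%:~R *
    (((den Z')%:~R - 2 * (den Z)%:~R) * (d1 ^+ 2 + d2 ^+ 2)
     - 2 * (d1 * err1 Z c + d2 * err2 Z c)).
  rewrite /sqerr /err1 /err2 /d1 /d2 /c /=; field.
  by rewrite gt_eqF.
rewrite mulr_ge0 ?(ltW q'0)// subr_ge0.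
apply: (@le_trans _ _ 0); first by lra.
by rewrite mulr_ge0 ?subr_ge0// addr_ge0 ?sqr_ge0.
Qed.

(** * From integer vectors to [psi] and its jumps *)

Definition row2 (R : realType) (t : R * R) : 'rV[R]_2 :=
  \row_i (if i == 0 then t.1 else t.2).

Lemma approx_errE (R : realType) (t : R * R) (q : nat) (p : 'rV[int]_2) :
  approx_err (row2 t) q p = Num.sqrt (sqerr (ZVec q%:Z (p 0 0) (p 0 1)) t).
Proof.
rewrite /approx_err /enorm; congr Num.sqrt.
rewrite big_ord_recl big_ord1 /sqerr /err1 /err2 !mxE /=.
by have -> : lift 0 0 = 1 :> 'I_2 by exact/val_inj.
Qed.

Lemma sqerr_ge0 (R : realType) (z : zvec) (t : R * R) : 0 <= sqerr z t.
Proof. by rewrite addr_ge0// sqr_ge0. Qed.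

Lemma psi_eq (R : realType) (t : R * R) (z z' : zvec) (x : R) :
  0 < den z -> (den z)%:~R <= x -> x < (den z')%:~R ->
  (forall W, 0 < den W < den z' -> sqerr z t <= sqerr W t) ->
  psi (row2 t) x = Num.sqrt (sqerr z t).
Proof.
move=> z0 zx xz' best.
have x1 : 1 <= x by apply: le_trans zx; rewrite ler1z -gtz0_ge1.
have [q [p [q0 qx -> qmin]]] := psi_min (row2 t) x1.
have zE : ZVec `|den z|%N%:Z (num1 z) (num2 z) = z.
  by rewrite gez0_abs ?ltW//; case: (z).
apply/eqP; rewrite eq_le; apply/andP; split.
- have := qmin `|den z|%N (\row_i (if i == 0 then num1 z else num2 z)).
  rewrite (approx_errE t `|den z|%N) !mxE /= zE; apply.
  + by rewrite absz_gt0 gt_eqF.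
  + by rewrite -[_%:R]/(_%:Z%:~R) gez0_abs// ltW.
- rewrite approx_errE ler_wsqrtr// best//= ltz_nat q0 -(ltr_int R).
  exact: le_lt_trans xz'.
Qed.

Lemma rational_row2 (R : realType) (t : R * R) : rational_point (row2 t) ->
  exists2 W : zvec, 0 < den W & sqerr W t = 0.
Proof.
move=> [r rE].
have t1 : t.1 = ratr (r 0 0).
  by have /rowP/(_ 0) := rE; rewrite !mxE.
have t2 : t.2 = ratr (r 0 1).
  by have /rowP/(_ 1) := rE; rewrite !mxE.
exists (ZVec (denq (r 0 0) * denq (r 0 1)) (numq (r 0 0) * denq (r 0 1))
  (numq (r 0 1) * denq (r 0 0))) => /=; first by rewrite mulr_gt0 ?denq_gt0.
rewrite /sqerr /err1 /err2 t1 t2 /ratr /=.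
have d1 : (denq (r 0 0))%:~R != 0 :> R by rewrite intr_eq0 denq_neq0.
have d2 : (denq (r 0 1))%:~R != 0 :> R by rewrite intr_eq0 denq_neq0.
by field; rewrite d1 d2.
Qed.

Theorem theorem1 (R : realType) (phi : R -> R)
    (phi_incr : forall s t : R, 0 < s -> s <= t -> phi s <= phi t)
    (phi_oo : phi t @[t --> +oo] --> +oo)
    (lambda : R) (lambda_ge0 : 0 <= lambda)
    (lambda_le : lambda <= 2 / Num.sqrt 3) :
  exists theta : 'rV[R]_2,
    [/\ ~ rational_point theta,
        d2 theta = lambda%:E
      & exists q : nat -> nat,
          [/\ best_denoms theta q,
              forall nu : nat, (0 < nu)%N ->
                phi nu%:R <= (q nu.+1)%:R / (q nu)%:R
            & ratio_limsup R q = +oo%E]].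
Proof.
have l3 : 3 * lambda ^+ 2 <= 4.
  have s0 : 0 < Num.sqrt 3 :> R by rewrite sqrtr_gt0.
  move: lambda_le; rewrite ler_pdivlMr// => h.
  have s3 : Num.sqrt 3 ^+ 2 = 3 :> R by rewrite sqr_sqrtr.
  have : (lambda * Num.sqrt 3) ^+ 2 <= 2 ^+ 2.
    by rewrite ler_sqr ?nnegrE// mulr_ge0// ltW.
  by rewrite exprMn s3; lra.
(* Index [n] governs the ratio for [nu = n.+1]. The maximum with [n.+1] gives the divergence of the
   ratios an explicit rate. *)
have [z [r [z1 zP]]] :=
  @zvec_sequence R (fun n => Num.max (phi n.+1%:R) n.+1%:R) lambda lambda_ge0 l3.
have [t tP] : exists t, forall n, box (ratpt (z n.+1)) (r n) t.
  apply: nested_boxes => n; first by have [] := zP n.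
  by have [_ _ _ _ sub] := zP n; move=> s /sub[].
have good n : good_step lambda n.+1%:R^-1 (z n) (z n.+1) (z n.+2) t.
  by have [_ _ _ _ sub] := zP n; have [] := sub _ (tP n.+1).
have z0 n : 0 < den (z n.+1) by have [] := zP n.
have z2 n : 2 * den (z n.+1) <= den (z n.+2) by have [] := zP n.
(* The competitor [z_(n+2) - z_(n+1)] is excluded only by the sign condition of the following step,
   [good n.+1]. *)
have best n W : 0 < den W < den (z n.+2) -> sqerr (z n.+1) t <= sqerr W t.
  move=> W0; have [near _ _ _] := good n; have [->//|->|//] := near W W0.
  apply: complement_longer => //.
  by have [_ ? _ _] := good n.+1.
have dec n : sqerr (z n.+2) t < sqerr (z n.+1) t by have [] := good n.
have approx n : `|(den (z n.+2))%:~R * sqerr (z n.+1) t - lambda| <= n.+1%:R^-1.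
  by have [] := good n.
have psiE n (x : R) : (den (z n.+1))%:~R <= x -> x < (den (z n.+2))%:~R ->
    psi (row2 t) x = Num.sqrt (sqerr (z n.+1) t).
  by move=> zx xz; exact: psi_eq xz (best n).
pose q n := `|den (z n)|%N.
have qE n : (q n.+1)%:R = (den (z n.+1))%:~R :> R.
  by rewrite -[_%:R]/(_%:Z%:~R) gez0_abs// ltW.
have qS n : (q n.+1 < q n.+2)%N.
  rewrite -ltz_nat !gez0_abs ?(ltW (z0 _))//; apply: lt_le_trans (z2 n).
  by rewrite ltr_pMl.
have zlt n : (den (z n.+1))%:~R < (den (z n.+2))%:~R :> R.
  by rewrite -!qE ltr_nat.
have qM : {homo (fun n => q n.+1) : m n / (m <= n)%N}.
  by apply: homo_leq => [//|x y w|n]; [exact: leq_trans|exact: ltnW].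
have q_gt n : (n < q n.+1)%N.
  by elim: n => [|n IH]; [rewrite /q z1|exact: leq_ltn_trans IH (qS n)].
have ratio n : Num.max (phi n.+1%:R) n.+1%:R <= (q n.+2)%:R / (q n.+1)%:R.
  rewrite ler_pdivlMr ?ltr0n ?(leq_ltn_trans _ (q_gt n))// !qE.
  by have [] := zP n.
(* Between consecutive denominators [psi] is constant, so [x psi^2] is at most the next denominator
   times [sqerr], which is within [1 / n.+1] of [lambda]. *)
have upper (e : R) : 0 < e -> (d2 (row2 t) <= (lambda + e)%:E)%E.
  move=> e0.
  pose N := Num.truncn e^-1.
  have Ne : N.+1%:R^-1 <= e.
    by rewrite -[leRHS]invrK lef_pV2 ?posrE ?invr_gt0// ltW// truncnS_gt.
  apply: ge_ereal_inf; exists (ereal_sup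
      ((fun x : R => (x * psi (row2 t) x ^+ 2)%:E) @`
         [set x : R | (den (z N.+1))%:~R <= x])).
    eexists; last by reflexivity.
    by exists (den (z N.+1))%:~R; split; [exact: num_real|move=> x /ltW].
  apply: ge_ereal_sup => _ [x /= Nx <-].
  have [n Nn /andP[nx xn]] : exists2 n, (N <= n)%N &
      (den (z n.+1))%:~R <= x < (den (z n.+2))%:~R.
    have ex : exists m, x < (q m.+1)%:R.
      exists (Num.truncn x).+1; apply: lt_trans (truncnS_gt x) _.
      by rewrite ltr_nat.
    have [m xm mmin] := ex_minnP ex.
    have Nm : (N < m)%N.
      rewrite ltnNge; apply/negP => mN.
      have : (q m.+1)%:R <= (q N.+1)%:R :> R by rewrite ler_nat; exact: qM.
      by rewrite (qE N) => ?; lra.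
    case: m Nm xm mmin => // m Nm xm mmin; exists m => //.
    rewrite -!qE xm andbT leNgt; apply/negP => /mmin.
    by rewrite ltnn.
  rewrite (psiE n)// sqr_sqrtr ?sqerr_ge0// lee_fin.
  have := approx n; rewrite ler_norml => /andP[_ up].
  have nN : n.+1%:R^-1 <= N.+1%:R^-1 :> R.
    by rewrite lef_pV2 ?posrE// ler_nat.
  apply: (@le_trans _ _ ((den (z n.+2))%:~R * sqerr (z n.+1) t)).
    by rewrite ler_wpM2r ?sqerr_ge0// ltW.
  by rewrite -lerBlDl; exact: le_trans up (le_trans nN Ne).
have lower (e : R) : 0 < e -> ((lambda - e)%:E <= d2 (row2 t))%E.
  move=> e0.
  apply: le_ereal_inf_tmp => _ [V [M [_ MV]] <-].
  apply: le_ereal_sup_tmp.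
  (* The total loss is at most [1 / n.+1] from [approx] plus [sqerr], itself at most
     [(lambda + 1) / n.+1]; hence the constant [lambda + 2]. *)
  pose n := Num.truncn (Num.max M ((lambda + 2) / e)).
  have : Num.max M ((lambda + 2) / e) < n.+1%:R by exact: truncnS_gt.
  rewrite gt_max => /andP[Mn en].
  (* A point just before the jump, where [x psi^2] falls short of [q_(n+2) sqerr] by only
     [sqerr]. *)
  pose x : R := (q n.+2)%:R - 1.
  have nq : n.+2%:R <= (q n.+2)%:R :> R by rewrite ler_nat q_gt.
  rewrite -natr1 in nq.
  exists (x * psi (row2 t) x ^+ 2)%:E.
    by exists x => //; apply: MV; rewrite /x; lra.
  have xq : (q n.+1)%:R <= x.
    by rewrite lerBrDr natr1 ler_nat.
  rewrite (psiE n) -?qE//; last by rewrite /x; lra.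
  rewrite sqr_sqrtr ?sqerr_ge0// lee_fin.
  have S0 := sqerr_ge0 (z n.+1) t.
  have n0 : 0 < n.+1%:R :> R by rewrite ltr0n.
  have n1 : n.+1%:R^-1 <= 1 :> R by rewrite invf_le1 ?ler1n.
  have nV : n.+1%:R^-1 * n.+1%:R = 1 :> R by rewrite mulVf ?gt_eqF.
  move: (approx n) n1 nV; rewrite ler_norml -qE.
  move: (n.+1%:R^-1) => i /andP[lo up] i1 iV.
  move: en; rewrite ltr_pdivrMr// => en.
  have : (i + sqerr (z n.+1) t) * n.+1%:R <= e * n.+1%:R.
    rewrite mulrDl iV.
    have : sqerr (z n.+1) t * n.+1%:R <= sqerr (z n.+1) t * (q n.+2)%:R.
      by rewrite ler_wpM2l//; lra.
    by lra.
  by rewrite ler_pM2r// /x; lra.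
exists (row2 t); split.
- move=> /rational_row2[W W0 W00].
  pose n := `|den W|%N.
  (* A rational [theta] would give a vector with zero error, forcing a minimal error to vanish;
     strict decrease of nonnegative errors forbids this. *)
  have : sqerr (z n.+1) t <= 0.
    rewrite -W00; apply: best; rewrite W0/= -(gtz0_abs W0) -(gtz0_abs (z0 n.+1)).
    by rewrite ltz_nat (leq_ltn_trans _ (q_gt n.+1)).
  by have := dec n; have := sqerr_ge0 (z n.+2) t; lra.
- apply/eqP; rewrite eq_le; apply/andP; split; apply/lee_addgt0Pr => e e0.
  + exact: upper.
  + by rewrite -leeBlDr//; exact: lower.
exists q; split.
- split => [|[|n]//|[|n]// _ x /andP[]|[|n]// _].
  + by rewrite /q z1.
  + rewrite !qE => qx xq; rewrite !(psiE n)//.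
  + rewrite !qE (psiE n.+1)// (psiE n)// lt_eqF// ltr_sqrt//.
    exact: le_lt_trans (sqerr_ge0 _ _) (dec n).
- by case=> // n _; apply: le_trans (ratio n); rewrite le_max lexx.
- apply: (cvg_limn_einf_sup _).2; apply/cvgeryP/cvgryPge => A.
  exists (Num.truncn A).+2 => // -[|[|n]]//= An.
  apply: le_trans (ratio n); rewrite le_max; apply/orP; right.
  by apply: ltW; apply: lt_le_trans (truncnS_gt A) _; rewrite ler_nat.
Qed.
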